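(* Let $t,\ell,\Delta$ be positive integers. Let $G$ be a graph of maximum degree $\Delta$ that is a subgraph of $H\boxtimes P\boxtimes K_\ell$ for some graph $H$ of treewidth at most $t$ and some path $P$. Then for every integer $k\geq 1$, the $k$-th power $G^k$ is a subgraph of $J\boxtimes P'\boxtimes K_{2k\ell\Delta^{k}(k^3+3k)}$ for some graph $J$ of treewidth at most $\binom{k+t}{t}-1$ and some path $P'$.
   Context: The $k$-th power $G^k$ has vertex set $V(G)$, with $vw$ an edge iff $v\neq w$ and $\mathrm{dist}_G(v,w)\leq k$. The strong product $A\boxtimes B$ has vertex set $V(A)\times V(B)$, with distinct $(v,x),(w,y)$ adjacent if ($v=w$ and $xy\in E(B)$), or ($x=y$ and $vw\in E(A)$), or ($vw\in E(A)$ and $xy\in E(B)$). $K_m$ is the complete graph on $m$ vertices. *)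

(* Defs.v *)
From mathcomp Require Import all_boot.
Set Implicit Arguments. Unset Strict Implicit. Unset Printing Implicit Defensive.

Record sgraph := SGraph {
  vertex :> finType;
  adj : rel vertex;
  adj_sym : symmetric adj;
  adj_irrefl : irreflexive adj }.
Arguments adj {s}.

Definition complete_adj m : rel 'I_m := fun i j => i != j.
Lemma complete_sym m : symmetric (@complete_adj m).
Proof. by move=> i j; rewrite /complete_adj eq_sym. Qed.
Lemma complete_irr m : irreflexive (@complete_adj m).
Proof. by move=> i; rewrite /complete_adj eqxx. Qed.
Definition complete m : sgraph := SGraph (@complete_sym m) (@complete_irr m).

Definition path_adj n : rel 'I_n.+1 :=
  fun i j => ((i : nat).+1 == j) || ((j : nat).+1 == i).
Lemma path_sym n : symmetric (@path_adj n).
Proof. by move=> i j; rewrite /path_adj orbC. Qed.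
Lemma path_irr n : irreflexive (@path_adj n).
Proof. by move=> i; rewrite /path_adj orbb (gtn_eqF (ltnSn i)). Qed.
Definition pathg n : sgraph := SGraph (@path_sym n) (@path_irr n).

Definition strong_adj (A B : sgraph) : rel (A * B)%type :=
  fun p q => [|| (p.1 == q.1) && adj p.2 q.2,
                 (p.2 == q.2) && adj p.1 q.1
               | adj p.1 q.1 && adj p.2 q.2].
Lemma strong_sym A B : symmetric (@strong_adj A B).
Proof.
by move=> [a b] [c d]; rewrite /strong_adj /= (eq_sym a) (eq_sym b)
  (adj_sym a) (adj_sym b).
Qed.
Lemma strong_irr A B : irreflexive (@strong_adj A B).
Proof. by move=> [a b]; rewrite /strong_adj /= !adj_irrefl !andbF. Qed.
Definition strong (A B : sgraph) : sgraph := SGraph (@strong_sym A B) (@strong_irr A B).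

(** dist_G(v,w) <= k : there is a walk of length exactly k when staying put
    is allowed, i.e. a walk of length at most k. *)
Definition adj_or_eq (G : sgraph) : rel G := fun a b => (a == b) || adj a b.
Definition within (G : sgraph) (k : nat) : rel G :=
  fun v w => [exists s : k.-tuple G, path (@adj_or_eq G) v s && (last v s == w)].

Lemma within_sym_imp (G : sgraph) k v w : @within G k v w -> @within G k w v.
Proof.
case/existsP=> s /andP[ps /eqP ls].
have sz : size (rev (belast v s)) == k by rewrite size_rev size_belast size_tuple.
apply/existsP; exists (Tuple sz) => /=; apply/andP; split.
  rewrite -ls rev_path; apply: sub_path ps => a b.
  by rewrite /adj_or_eq eq_sym adj_sym.
case: (tval s) ls => [|x s'] /= ls; first by rewrite ls.
by rewrite rev_cons last_rcons.
Qed.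

Definition power_adj (G : sgraph) (k : nat) : rel G :=
  fun v w => (v != w) && within k v w.
Lemma power_sym G k : symmetric (@power_adj G k).
Proof.
move=> v w; rewrite /power_adj eq_sym; congr andb.
by apply/idP/idP; apply: within_sym_imp.
Qed.
Lemma power_irr G k : irreflexive (@power_adj G k).
Proof. by move=> v; rewrite /power_adj eqxx. Qed.
Definition power (G : sgraph) (k : nat) : sgraph :=
  SGraph (@power_sym G k) (@power_irr G k).

Definition deg (G : sgraph) (v : G) : nat := #|[set u | adj v u]|.
Definition maxdeg (G : sgraph) : nat := \max_(v : G) deg v.

Definition subgraph (G H : sgraph) : Prop :=
  exists f : G -> H, injective f /\ forall u v, adj u v -> adj (f u) (f v).

Definition connected (G : sgraph) : Prop := forall x y : G, connect adj x y.
Definition acyclic (G : sgraph) : Prop :=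
  ~ exists s : seq G, [&& uniq s, 3 <= size s & cycle adj s].
Definition is_tree (G : sgraph) : Prop := connected G /\ acyclic G.

Definition connected_in (G : sgraph) (S : {set G}) : Prop :=
  forall x y, x \in S -> y \in S ->
    connect [rel a b | [&& a \in S, b \in S & adj a b]] x y.

Definition tree_decomposition (G T : sgraph) (B : T -> {set G}) : Prop :=
  [/\ is_tree T,
      forall v : G, exists t : T, v \in B t,
      forall u v : G, adj u v -> exists t : T, (u \in B t) && (v \in B t)
    & forall v : G, connected_in [set t | v \in B t]].

Definition treewidth_le (G : sgraph) (w : nat) : Prop :=
  exists (T : sgraph) (B : T -> {set G}),
    tree_decomposition B /\ forall t, #|B t| <= w.+1.

(* Main.v *)
Require Import Defs.
From mathcomp Require Import all_boot zify.

(** A tree-decomposition of [H] of width [t] gives an elimination order of [H]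
    in which the earlier neighbours of each vertex, in a chordal completion, form
    a clique of size at most [t].  Let [W v] be the set of vertices reachable from
    [v] by at most [k] steps towards earlier vertices.  The sets [W v] have at most
    ['C(k + t, t)] elements and are the bags of a tree-decomposition of the graph
    [J] on [V(H)] that joins [v] to the elements of [W v].

    Send each vertex [v] of [G] to the earliest vertex [a v] of [H] in the
    projection of the ball of radius [k] around [v].  If [v] and [w] are at distance
    at most [k], then [a v] and [a w] are both reachable upwards from the projection
    of [v], which forces one of them to lie in [W] of the other.  Finally the rows of
    the path are grouped in blocks of [k].  A vertex with given [a v] and given block
    is within distance [k] of one of at most [3 k l] vertices projecting to [a v],
    so each fibre has at most [3 k l (k + 1) D^k] elements. *)

Set Implicit Arguments.
Unset Strict Implicit.
Unset Printing Implicit Defensive.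

(** * Walks *)

Lemma withinP (G : sgraph) k (v w : G) :
  reflect (exists s, [/\ size s = k, path (@adj_or_eq G) v s & last v s = w])
    (within k v w).
Proof.
apply: (iffP existsP) => [[s /andP[ps /eqP ls]]|[s [/eqP sz ps ls]]].
  by exists s; rewrite size_tuple.
by exists (Tuple sz); rewrite /= ps ls eqxx.
Qed.

Lemma within0 (G : sgraph) (v w : G) : within 0 v w = (v == w).
Proof.
apply/withinP/eqP => [[s [/size0nil-> _ /=]]//|->].
by exists [::].
Qed.

Lemma withinSP (G : sgraph) k (v w : G) :
  reflect (exists2 u, adj_or_eq v u & within k u w) (within k.+1 v w).
Proof.
apply: (iffP (withinP _ _ _)) => [[[|u s] []//= [sz] /andP[vu ps] ls]|].
  by exists u => //; apply/withinP; exists s.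
case=> u vu /withinP[s [sz ps ls]].
by exists (u :: s); rewrite /= sz vu ps.
Qed.

Lemma adj_or_eq_refl (G : sgraph) : reflexive (@adj_or_eq G).
Proof. by move=> v; rewrite /adj_or_eq eqxx. Qed.

Lemma within_refl (G : sgraph) k (v : G) : within k v v.
Proof.
elim: k => [|k IH]; first by rewrite within0.
by apply/withinSP; exists v => //; apply: adj_or_eq_refl.
Qed.

Lemma within_prefix (G : sgraph) (v x : G) s :
  path (@adj_or_eq G) v s -> x \in v :: s -> within (size s) v x.
Proof.
elim: s v => [|u s IH] v /=; first by rewrite within0 inE eq_sym.
case/andP=> vu ps; rewrite inE => /predU1P[->|xs]; first exact: within_refl.
by apply/withinSP; exists u => //; apply: IH.
Qed.

(** Unlike in [within], staying put is excluded, so each step multiplies the number of ends by at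
    most the maximum degree. The ball of radius [k] is covered by these sets for the lengths up to
    [k]. *)
Fixpoint walk_ends (G : sgraph) k (v : G) : {set G} :=
  if k is j.+1 then \bigcup_(u in [set u | adj v u]) walk_ends j u else [set v].

Lemma leq_card_bigcup (I T : finType) (A : {set I}) (F : I -> {set T}) m :
  (forall i, i \in A -> #|F i| <= m) -> #|\bigcup_(i in A) F i| <= #|A| * m.
Proof.
move=> Fm; rewrite -sum_nat_const.
apply: (@leq_trans (\sum_(i in A) #|F i|)); last exact: leq_sum.
elim/big_rec2: _ => [|i n S _ IH]; first by rewrite cards0.
by rewrite cardsU (leq_trans (leq_subr _ _)) // leq_add2l.
Qed.

Lemma card_walk_ends (G : sgraph) k (v : G) : #|walk_ends k v| <= maxdeg G ^ k.
Proof.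
elim: k v => [|k IH] v /=; first by rewrite cards1.
rewrite expnS (leq_trans (leq_card_bigcup (fun u _ => IH u))) // leq_mul2r.
by rewrite (leq_bigmax v : deg v <= maxdeg G) orbT.
Qed.

Lemma within_walk_ends (G : sgraph) k (v w : G) :
  within k v w -> w \in \bigcup_(i in [set: 'I_k.+1]) walk_ends i v.
Proof.
suff: within k v w -> exists2 i, i <= k & w \in walk_ends i v.
  move=> ex /ex[i ik wi]; apply/bigcupP; exists (Ordinal (ik : i < k.+1)) => //.
elim: k v => [|k IH] v; first by rewrite within0 => /eqP->; exists 0; rewrite //= inE.
case/withinSP=> u vu /IH[i ik wi]; case/orP: vu => [/eqP->|vu].
  by exists i => //; apply: leqW.
by exists i.+1 => //=; apply/bigcupP; exists u; rewrite ?inE.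
Qed.

Lemma card_ball (G : sgraph) k (v : G) :
  0 < maxdeg G -> #|[set w | within k v w]| <= k.+1 * maxdeg G ^ k.
Proof.
move=> D0; apply: (@leq_trans #|\bigcup_(i in [set: 'I_k.+1]) walk_ends i v|).
  by apply/subset_leq_card/subsetP => w; rewrite inE; apply: within_walk_ends.
rewrite -[in X in _ <= X](card_ord k.+1) -cardsT; apply: leq_card_bigcup => i _.
by rewrite (leq_trans (card_walk_ends i v)) // leq_pexp2l // -ltnS.
Qed.

(** * Elimination orders *)

(** [N v] plays the role of the earlier neighbours of [v] in a chordal completion; the completion
    itself is not built. *)
Record elimination (V : finType) (idx : V -> nat) (N : V -> {set V}) : Prop :=
  Elimination {
    elim_inj : injective idx;
    elim_lt : forall u v, u \in N v -> idx u < idx v;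
    elim_clique : forall u w v,
      u \in N v -> w \in N v -> idx u < idx w -> u \in N w }.

(* [upreach N k v] is the set of vertices weakly [k]-reachable from [v]: in a
   chordal graph a shortest path witnessing weak reachability is monotone. *)
Fixpoint upreach (V : finType) (N : V -> {set V}) k (v : V) : {set V} :=
  if k is j.+1 then v |: \bigcup_(p in N v) upreach N j p else [set v].

Section Upreach.
Variables (V : finType) (idx : V -> nat).
Implicit Types (N : V -> {set V}) (u v w m p x y : V).

Lemma upreach_self N k v : v \in upreach N k v.
Proof. by case: k => [|k] /=; rewrite !inE eqxx. Qed.

Lemma upreachSP N k v m :
  reflect (m = v \/ exists2 p, p \in N v & m \in upreach N k p)
    (m \in upreach N k.+1 v).
Proof.
rewrite /= !inE; apply: (iffP orP) => [[/eqP|/bigcupP]|[->|]]; try by [left|right].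
by right; apply/bigcupP.
Qed.

Lemma upreach_step N k v p m :
  p \in N v -> m \in upreach N k p -> m \in upreach N k.+1 v.
Proof. by move=> pv mp; apply/upreachSP; right; exists p. Qed.

Lemma upreach_leS N k v m : m \in upreach N k v -> m \in upreach N k.+1 v.
Proof.
elim: k v => [|k IH] v; first by rewrite inE => /eqP->; apply: upreach_self.
case/upreachSP=> [->|[p pv mp]]; first exact: upreach_self.
by apply: (upreach_step pv); apply: IH.
Qed.

Lemma upreach_idx N k v m :
  elimination idx N -> m \in upreach N k v -> idx m <= idx v.
Proof.
move=> eN; elim: k v => [|k IH] v; first by rewrite inE => /eqP->.
case/upreachSP=> [->//|[p pv /IH mp]].
exact: leq_trans mp (ltnW (elim_lt eN pv)).
Qed.

(** The first step from [x] towards [m] leads to a parent [p], comparable with [y] by the clique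
    property. If [p] precedes [y], it is a parent of [y]; if it follows, [y] is a parent of [p] and
    induction continues from [p]. *)
Lemma upreach_parent N k x y m : elimination idx N ->
  y \in N x -> m \in upreach N k x -> idx m <= idx y -> m \in upreach N k y.
Proof.
move=> eN; elim: k x => [|k IH] x yx.
  by rewrite inE => /eqP-> ; rewrite leqNgt (elim_lt eN yx).
case/upreachSP=> [->|[p px mp]] my; first by move: my; rewrite leqNgt (elim_lt eN yx).
case: (ltngtP (idx p) (idx y)) => [py|yp|/(elim_inj eN) <-].
- exact: upreach_step (elim_clique eN px yx py) mp.
- by apply: upreach_leS; apply: (IH p) => //; apply: (elim_clique eN yx px).
- exact: upreach_leS.
Qed.

(** Climbing from [x] to [a] one parent at a time, [upreach_parent] keeps [m] reachable within the
    same [k] steps, whatever [i] is. *)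
Lemma upreach_between N i k x a m : elimination idx N ->
  a \in upreach N i x -> m \in upreach N k x -> idx m <= idx a ->
  m \in upreach N k a.
Proof.
move=> eN; elim: i x => [|i IH] x; first by rewrite inE => /eqP->.
case/upreachSP=> [->//|[p px ap]] mx ma.
apply: (IH p) => //; apply: (upreach_parent eN px) => //.
exact: leq_trans ma (upreach_idx eN ap).
Qed.

(* With [u] the topmost parent of [v], every vertex up-reachable from [v] is
   either reachable from [u] in one step fewer, or reached through vertices
   that all have [u] as a parent; this yields Pascal's recurrence. *)
Lemma card_upreach N t k v : elimination idx N ->
  (forall x, #|N x| <= t) -> #|upreach N k v| <= 'C(k + t, t).
Proof.
elim: t N k v => [|t IHt] N k v eN Nt.
  rewrite bin0 -(cards1 v) subset_leq_card //; apply/subsetP => m.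
  case: k => [|k]; first by [].
  case/upreachSP=> [->|[p]]; first exact: set11.
  by move: (Nt v); rewrite leqn0 cards_eq0 => /eqP->; rewrite in_set0.
elim: k v => [|k IHk] v; first by rewrite cards1 add0n binn.
have [Nv0|[u0 u0v]] := set_0Vmem (N v).
  rewrite (@leq_trans 1) ?bin_gt0 ?leq_addl // -(cards1 v) subset_leq_card //.
  by apply/subsetP=> m /upreachSP[->|[p]]; rewrite ?Nv0 !inE.
case: (arg_minnP idx u0v) => u uv umin.
(* Only vertices with parent [u] keep parents, and only those after [u]. Losing [u] itself lowers
   the bound on parent sets to [t]. *)
pose M x := if u \in N x then [set y in N x | idx u < idx y] else set0.
have MP x y : reflect [/\ u \in N x, y \in N x & idx u < idx y] (y \in M x).
  rewrite /M; case: ifP => ux; rewrite !inE; last by constructor=> -[].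
  by apply: (iffP andP) => [[]|[]].
have eM : elimination idx M.
  split; first exact: elim_inj eN.
    by move=> y x /MP[_ /(elim_lt eN)].
  move=> y w x /MP[ux yx uy] /MP[_ wx uw] yw; apply/MP; split=> //.
    exact: elim_clique eN _ _ _ ux wx uw.
  exact: elim_clique eN _ _ _ yx wx yw.
have Mt x : #|M x| <= t.
  rewrite /M; case: ifP => ux; last by rewrite cards0.
  rewrite -ltnS; apply: leq_trans (Nt x); rewrite (cardsD1 u (N x)) ux ltnS.
  apply/subset_leq_card/subsetP => y; rewrite !inE => /andP[-> uy].
  by rewrite andbT; apply: contraTneq uy => ->; rewrite ltnn.
(* A route upwards from [x] either stays after [u], hence follows [M], or reaches [u] or a parent of
   [u], so that its end is reachable from [u]. *)
have below j x : u \in N x -> upreach N j x \subset upreach N j u :|: upreach M j x.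
  elim: j x => [|j IH] x ux; first exact: subsetUr.
  apply/subsetP => m /upreachSP mx; rewrite in_setU.
  case: mx => [->|[p px mp]]; first by rewrite upreach_self orbT.
  case: (ltngtP (idx p) (idx u)) => [pu|up|/(elim_inj eN) pu].
  - by rewrite (upreach_step (elim_clique eN px ux pu) mp).
  - have /IH/subsetP/(_ m mp) : u \in N p by apply: (elim_clique eN ux px).
    rewrite in_setU => /orP[/upreach_leS->//|mM].
    by rewrite orbC (@upreach_step _ _ _ p) //; apply/MP.
  - by rewrite -pu upreach_leS.
have sub : upreach N k.+1 v \subset upreach N k u :|: upreach M k.+1 v.
  apply/subsetP => m /upreachSP mv; rewrite in_setU.
  case: mv => [->|[p pv mp]]; first by rewrite upreach_self orbT.
  move: (umin p pv); rewrite leq_eqVlt => /predU1P[/(elim_inj eN)->|up].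
    by rewrite mp.
  have /(below k)/subsetP/(_ m mp) : u \in N p by apply: (elim_clique eN uv pv).
  rewrite in_setU => /orP[->//|mM].
  by rewrite orbC (@upreach_step _ _ _ p) //; apply/MP.
apply: (leq_trans (subset_leq_card sub)); rewrite cardsU (leq_trans (leq_subr _ _)) //.
rewrite addSn binS; apply: leq_add; first exact: IHk.
by rewrite -addSnnS; apply: IHt.
Qed.

End Upreach.

(** * Projected walks and upward reachability *)

Section UpreachWalk.
Variables (G : sgraph) (V : finType) (idx : V -> nat) (N : V -> {set V}) (h : G -> V).
Hypothesis eN : elimination idx N.
Hypothesis hN :
  forall x y, adj x y -> [\/ h x = h y, h x \in N (h y) | h y \in N (h x)].

(** If [h y] is a parent of [h x], one upward step is added. If [h x] is a parent of [h y],
    [upreach_parent] applies because [m] is not later than [h x]. *)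
Lemma upreach_adj x y m i : adj_or_eq x y -> idx m <= idx (h x) ->
  m \in upreach N i (h y) -> m \in upreach N i.+1 (h x).
Proof.
move=> xy mx my; case/orP: xy => [/eqP->|/hN[->|xy|yx]]; try exact: upreach_leS.
  exact: upreach_leS (upreach_parent eN xy my mx).
exact: upreach_step yx my.
Qed.

Lemma upreach_walk v s : path (@adj_or_eq G) v s ->
  (forall x, x \in v :: s -> idx (h (last v s)) <= idx (h x)) ->
  h (last v s) \in upreach N (size s) (h v).
Proof.
elim: s v => [|u s IH] v /=; first by rewrite inE.
case/andP=> vu ps vmin; apply: (upreach_adj vu) (vmin v (mem_head _ _)) _.
by apply: IH => // x xs; apply: vmin; rewrite inE xs orbT.
Qed.

Lemma upreach_walk_end v s m i : path (@adj_or_eq G) v s ->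
  (forall x, x \in s -> idx m <= idx (h x)) ->
  m \in upreach N i (h v) -> m \in upreach N (i + size s) (h (last v s)).
Proof.
elim: s v i => [|u s IH] v i /=; first by rewrite addn0.
case/andP=> vu ps smin mv; rewrite -addSnnS; apply: IH => //.
  by move=> x xs; apply: smin; rewrite inE xs orbT.
apply: upreach_adj (smin u (mem_head _ _)) mv.
by rewrite /adj_or_eq eq_sym adj_sym.
Qed.

End UpreachWalk.

(** * Rooted trees *)

Section RootedTree.
Variables (T : sgraph) (r : T).

Record rooting (d : T -> nat) (par : T -> T) : Prop := Rooting {
  rooting_root : d r = 0;
  rooting_depth : forall x, x != r -> d x = (d (par x)).+1;
  rooting_edge : forall x y, adj x y ->
    (x != r /\ y = par x) \/ (y != r /\ x = par y) }.

(** A path avoiding the edge, once shortened to have no repeated vertex, closes with the edge to a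
    cycle of at least three vertices. *)
Lemma acyclic_bridge (x z : T) : acyclic T -> adj x z ->
  ~~ connect [rel a b | [&& adj a b, (a, b) != (x, z) & (a, b) != (z, x)]] x z.
Proof.
move=> acT xz; apply/negP => /connectP[p0 /shortenP[p pe up _] zl]; apply: acT.
exists (x :: p); rewrite up /= rcons_path -zl adj_sym xz andbT.
have -> : path adj x p by apply: sub_path pe => a b /andP[].
rewrite andbT; case: p pe zl {up} => [|y [|y' p]] //=.
  by move=> _ zx; move: xz; rewrite zx adj_irrefl.
by move=> /andP[/and3P[_ yz _] _] zy; rewrite zy eqxx in yz.
Qed.

(** The depth is the distance to [r], and a parent is a neighbour one step closer. Any other edge
    would lie on a closed route through [r], although every edge is a bridge. *)
Lemma tree_rooting : is_tree T -> exists d par, rooting d par.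
Proof.
move=> [cT acT].
have ex x : exists n, within n x r.
  have /connectP[p pp ->] := cT x r; exists (size p); apply/withinP; exists p.
  by split=> //; apply: sub_path pp => a b ab; rewrite /adj_or_eq ab orbT.
pose d x := ex_minn (ex x).
have dP x : within (d x) x r by rewrite /d; case: ex_minnP.
have dmin x n : within n x r -> d x <= n by rewrite /d; case: ex_minnP => m _; apply.
have d0 x : x != r -> exists y, adj x y && ((d y).+1 == d x).
  move=> xr; have := dP x; case dx: (d x) => [|n]; first by rewrite within0 (negPf xr).
  case/withinSP=> y /orP[/eqP<- /dmin|xy yr]; first by rewrite dx ltnn.
  exists y; rewrite xy eqSS eqn_leq dmin //= -ltnS -dx; apply: dmin.
  by apply/withinSP; exists y; rewrite // /adj_or_eq xy orbT.
pose par x := odflt x [pick y | adj x y && ((d y).+1 == d x)].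
have parP x : x != r -> adj x (par x) /\ d x = (d (par x)).+1.
  move=> /d0[y0 y0P]; rewrite /par; case: pickP => [y /andP[xy /eqP]//|/(_ y0)].
  by rewrite y0P.
exists d, par; split=> [|x /parP[]//|].
  by apply/eqP; rewrite -leqn0 dmin // within_refl.
suff edge x z : adj x z -> d z <= d x -> x != r /\ z = par x.
  move=> x y xy; case: (leqP (d y) (d x)) => [le|/ltnW le]; first by left; apply: edge.
  by right; apply: edge; rewrite // adj_sym.
move=> xz dzx.
have xr : x != r.
  apply: contraTneq xz => xr; move: dzx (dP z).
  have -> : d x = 0 by apply/eqP; rewrite -leqn0 dmin // within0 xr.
  by rewrite leqn0 => /eqP->; rewrite within0 xr => /eqP->; rewrite adj_irrefl.
split=> //; apply/eqP; apply: contraT => zy.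
pose e := [rel a b | [&& adj a b, (a, b) != (x, z) & (a, b) != (z, x)]].
have esym : connect_sym e.
  apply: sym_connect_sym => a b /=; rewrite adj_sym !xpair_eqE.
  by rewrite (andbC (a == x)) (andbC (a == z)); congr (_ && _); rewrite andbC.
(* Depth drops strictly along parents, so the climb from [w] never meets [x] and avoids the edge
   between [x] and [z]. *)
have toroot n w : d w <= n -> w != x -> d w <= d x -> connect e w r.
  elim: n w => [|n IH] w dn wx dwx; have [->|wr] := eqVneq w r; rewrite ?connect0 //.
    by have [_ dw] := parP w wr; rewrite dw in dn.
  have [wp dw] := parP w wr; have px : par w != x.
    by apply: contraTneq dwx => <-; rewrite dw ltnn.
  apply: (connect_trans (y := par w)).
    by apply: connect1; rewrite /= wp !xpair_eqE (negPf wx) (negPf px) andbF.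
  by apply: IH => //; lia.
have [xy dx] := parP x xr.
have := acyclic_bridge acT xz; rewrite -/e => /negP[].
apply: (connect_trans (y := par x)).
  apply: connect1; rewrite /= xy !xpair_eqE eqxx eq_sym zy /=.
  by apply/nandP; left; apply: contraTneq xz => ->; rewrite adj_irrefl.
apply: (connect_trans (y := r)).
  apply: (toroot (d x)); try by rewrite dx leqnSn.
  by apply: contraTneq xy => ->; rewrite adj_irrefl.
rewrite esym; apply: (toroot (d x)) => //.
by apply: contraTneq xz => ->; rewrite adj_irrefl.
Qed.

Variables (d : T -> nat) (par : T -> T).
Hypothesis rT : rooting d par.

(* A walk in [S] from [x] to [m] leaves the subtree below [x] at most along the
   edge from [x] to its parent. *)
Lemma connected_par_or_below (S : {set T}) x m : connected_in S ->
  x \in S -> m \in S ->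
  (x != r /\ par x \in S) \/ exists i, d m = d x + i /\ iter i par m = x.
Proof.
move=> cS xS mS; have /connectP[p] := cS x m xS mS.
pose below y := exists i, d y = d x + i /\ iter i par y = x.
suff walk y : below y ->
    path [rel a b | [&& a \in S, b \in S & adj a b]] y p -> m = last y p ->
    (x != r /\ par x \in S) \/ below m.
  by apply: walk; exists 0; rewrite addn0.
elim: p y => [|z p IH] y /= ybelow; first by move=> _ ->; right.
case/andP=> /and3P[yS zS yz] pz lz; case: ybelow => i [dy iy].
case: (rooting_edge rT yz) => [[yr zy]|[zr yz']]; last first.
  apply: IH pz lz; exists i.+1; rewrite (rooting_depth rT zr) -yz' dy addnS.
  by rewrite iterSr -yz'.
case: i dy iy => [|i] dy iy; first by left; move: iy => /= <-; rewrite -zy.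
apply: IH pz lz; exists i; split; last by rewrite zy -iterSr.
by move: dy; rewrite (rooting_depth rT yr) -zy addnS => -[].
Qed.

Lemma connected_par (S : {set T}) x m : connected_in S ->
  x \in S -> m \in S -> d m < d x -> par x \in S.
Proof.
move=> cS xS mS dm; case: (connected_par_or_below cS xS mS) => [[]//|[i [dmi _]]].
by move: dm; rewrite dmi ltnNge leq_addr.
Qed.

Lemma connected_top_uniq (S : {set T}) x m : connected_in S ->
  x \in S -> m \in S -> d x = d m -> (forall y, y \in S -> d m <= d y) -> x = m.
Proof.
move=> cS xS mS dxm mmin.
case: (connected_par_or_below cS xS mS) => [[xr /mmin]|[i []]].
  by rewrite -dxm (rooting_depth rT xr) ltnn.
by rewrite -dxm -{1}[d x]addn0 => /addnI<-.
Qed.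

Lemma connected_ancestor (S : {set T}) s m i : connected_in S ->
  s \in S -> m \in S -> i <= d s - d m ->
  iter i par s \in S /\ d (iter i par s) = d s - i.
Proof.
move=> cS sS mS; elim: i => [|i IH] im; first by rewrite subn0.
have [iS di] := IH (ltnW im).
have lt : d m < d (iter i par s) by rewrite di; lia.
split=> /=; first exact: connected_par cS iS mS lt.
have nr : iter i par s != r.
  by apply: contraTneq lt => ->; rewrite (rooting_root rT).
by move: di; rewrite (rooting_depth rT nr); lia.
Qed.

End RootedTree.

(** Vertices are ordered by the depth of the highest node whose bag contains them, and [N v]
    consists of the earlier vertices in the highest bag of [v]. *)
Lemma treewidth_elimination (H : sgraph) t : treewidth_le H t ->
  exists (idx : H -> nat) (N : H -> {set H}),
    [/\ elimination idx N, forall v, #|N v| <= t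
      & forall u v, adj u v -> u \in N v \/ v \in N u].
Proof.
move=> [T [B [[treeT cover edges conn] width]]].
have [/card0_eq H0|/card_gt0P[v0 _]] := posnP #|H|.
  exists (fun=> 0), (fun=> set0); split; last by move=> u; have := H0 u.
    by split=> u; have := H0 u.
  by move=> v; rewrite cards0.
have [r _] := cover v0; have [d [par rT]] := tree_rooting r treeT.
have topex v : exists s, [/\ v \in B s & forall s', v \in B s' -> d s <= d s'].
  have [s0 vs0] := cover v; case: (arg_minnP (P := fun s => v \in B s) d vs0) => s vs mn.
  by exists s.
have {topex}[top topP] := fin_all_exists topex.
have vtop v : v \in B (top v) by case: (topP v).
(* Climbing from [s] to the depth of [top w] keeps both vertices in the bags, and the node reached
   is [top w] by uniqueness of the highest node. *)
have share u w s : u \in B s -> w \in B s -> d (top u) <= d (top w) -> u \in B (top w).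
  move=> us ws duw.
  have dws : d (top w) <= d s by case: (topP w) => _; apply.
  have anc x i : x \in B s -> i <= d s - d (top x) ->
      x \in B (iter i par s) /\ d (iter i par s) = d s - i.
    move=> xs ile; have := connected_ancestor rT (s := s) (m := top x) (conn x).
    by move=> /(_ i); rewrite !inE; apply.
  have [wi di] := anc w (d s - d (top w)) ws (leqnn _).
  have [ui _] := anc u (d s - d (top w)) us (leq_sub2l _ duw).
  suff <- : iter (d s - d (top w)) par s = top w by [].
  rewrite subKn // in di; apply: (connected_top_uniq rT (conn w)); rewrite ?inE //.
  by move=> y; rewrite inE; case: (topP w) => _; apply.
(* The factor lets depth dominate, while the rank breaks ties and is recovered as a residue. *)
pose idx v := d (top v) * #|H| + enum_rank v.
have idx_lt u v : idx u < idx v -> d (top u) <= d (top v).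
  rewrite /idx => uv; rewrite leqNgt; apply/negP => lt; move: uv.
  apply/negP; rewrite -leqNgt.
  apply: (@leq_trans ((d (top v)).+1 * #|H|)); first by rewrite mulSn addnC leq_add2r ltnW.
  by apply: leq_trans (leq_addr _ _); rewrite leq_mul2r lt orbT.
pose N v := [set u in B (top v) | idx u < idx v].
have idx_inj : injective idx.
  move=> u v uv; apply/enum_rank_inj/val_inj => /=.
  have : idx u %% #|H| = idx v %% #|H| by rewrite uv.
  by rewrite !modnMDl !modn_small.
have shareN u w s : u \in B s -> w \in B s -> idx u < idx w -> u \in N w.
  by move=> us ws uw; rewrite inE uw (share u w s) ?idx_lt.
exists idx, N; split.
- split=> // [u v|u w v]; first by rewrite inE => /andP[].
  by rewrite !inE => /andP[uv _] /andP[wv _] /(shareN _ _ _ uv wv); rewrite inE.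
- move=> v; rewrite -ltnS; apply: leq_trans (width (top v)).
  rewrite (cardsD1 v (B _)) vtop ltnS; apply/subset_leq_card/subsetP => u.
  by rewrite !inE => /andP[-> uv]; rewrite andbT; apply: contraTneq uv => ->; rewrite ltnn.
- move=> u v uv; have [s /andP[us vs]] := edges u v uv.
  case: (ltngtP (idx u) (idx v)) => [lt|lt|/idx_inj e].
  + by left; apply: (shareN u v s).
  + by right; apply: (shareN v u s).
  + by move: uv; rewrite e adj_irrefl.
Qed.

(** * Trees given by a parent function *)

Section ParentTree.
Variables (V : finType) (par : V -> V) (d : V -> nat) (r : V).
Hypothesis par_depth : forall x, x != r -> d (par x) < d x.

Definition parent_adj : rel V :=
  fun x y => ((x != r) && (par x == y)) || ((y != r) && (par y == x)).

Lemma parent_adj_sym : symmetric parent_adj.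
Proof. by move=> x y; rewrite /parent_adj orbC. Qed.

Lemma parent_adj_irrefl : irreflexive parent_adj.
Proof.
move=> x; rewrite /parent_adj orbb; apply/negP => /andP[/par_depth + /eqP xx].
by rewrite xx ltnn.
Qed.

Definition parent_graph : sgraph := SGraph parent_adj_sym parent_adj_irrefl.

Lemma parent_graph_tree : is_tree parent_graph.
Proof.
split.
  suff toroot n (x : parent_graph) : d x <= n -> connect adj x (r : parent_graph).
    move=> x y; apply: (connect_trans (toroot _ x (leqnn _))).
    by rewrite (sym_connect_sym (@adj_sym parent_graph)); apply: toroot (leqnn _).
  elim: n x => [|n IH] x xn; have [->|xr] := eqVneq x r; rewrite ?connect0 //;
    have := par_depth xr; move=> lt; first by lia.
  apply: (connect_trans (y := (par x : parent_graph))); last by apply: IH; lia.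
  by apply: connect1; rewrite /= /parent_adj xr eqxx.
(* Both neighbours of a deepest vertex of a cycle are its parent. *)
case=> -[|x0 s0] // /and3P[us ss cs].
case: (arg_maxnP (P := fun x => x \in x0 :: s0) d (mem_head x0 s0)) => x xs xmax.
have up y : y \in x0 :: s0 -> @adj parent_graph x y -> y = par x.
  move=> /xmax yx /orP[/andP[_ /eqP->]//|/andP[/par_depth + /eqP yx']].
  by rewrite yx' ltnNge (yx : d y <= d x).
have [i s e] := rot_to xs.
have us' : uniq (x :: s) by rewrite -e rot_uniq.
have cs' : cycle (@adj parent_graph) (x :: s) by rewrite -e rot_cycle.
have ss' : 3 <= size (x :: s) by rewrite -e size_rot.
have ms y : y \in s -> y \in x0 :: s0 by move=> ys; rewrite -(mem_rot i) e inE ys orbT.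
case: s us' cs' ss' ms {e} => [|y [|z s]] //= /and4P[_ yzs _ _] /and3P[xy _ ps] _ ms.
move: ps; rewrite rcons_path => /andP[_ lx].
have ls : last z s \in z :: s by apply: mem_last.
case/negP: yzs; rewrite (up y) ?ms ?mem_head // -(up (last z s)) ?ls //.
  by apply: ms; rewrite inE ls orbT.
by rewrite adj_sym.
Qed.

(** Iterating the parent map leads from every element of [S] to [m] inside [S], since depth cannot
    drop forever. *)
Lemma parent_graph_connected_in (S : {set V}) m :
  (forall x, x \in S -> x != m -> x != r /\ par x \in S) ->
  @connected_in parent_graph S.
Proof.
move=> Spar; set e : rel V := [rel a b | [&& a \in S, b \in S & parent_adj a b]].
have esym : connect_sym e.
  by apply: sym_connect_sym => a b; rewrite /e /= parent_adj_sym andbCA.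
suff tom n (x : V) : d x <= n -> x \in S -> connect e x m.
  move=> x y xS yS; apply: (connect_trans (tom _ x (leqnn _) xS)).
  by rewrite esym; apply: tom (leqnn _) yS.
elim: n x => [|n IH] x xn xS; have [->|xm] := eqVneq x m; rewrite ?connect0 //;
  have [xr pS] := Spar x xS xm; have lt := par_depth xr; first by lia.
apply: (connect_trans (y := par x)); last by apply: IH => //; lia.
by apply: connect1; rewrite /e /= xS pS /parent_adj xr eqxx.
Qed.

End ParentTree.

(** * The host graph *)

Section ReachGraph.
Variables (V : finType) (idx : V -> nat) (N : V -> {set V}) (k : nat).
Hypothesis eN : elimination idx N.

Definition reach_adj : rel V :=
  fun u v => (u != v) && ((u \in upreach N k v) || (v \in upreach N k u)).

Lemma reach_adj_sym : symmetric reach_adj.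
Proof. by move=> u v; rewrite /reach_adj eq_sym orbC. Qed.

Lemma reach_adj_irrefl : irreflexive reach_adj.
Proof. by move=> u; rewrite /reach_adj eqxx. Qed.

Definition reach_graph : sgraph := SGraph reach_adj_sym reach_adj_irrefl.

(** This is the parent map of the elimination tree, used to arrange the bags; it is [None] when
    [N v] is empty. *)
Definition deepest_parent (v : V) : option V :=
  [pick p in N v | [forall q in N v, idx q <= idx p]].

Lemma deepest_parentP v q : q \in N v ->
  exists2 p, deepest_parent v = Some p &
    p \in N v /\ forall q', q' \in N v -> idx q' <= idx p.
Proof.
move=> qv; rewrite /deepest_parent; case: pickP => [p /andP[pv /forall_inP pm]|].
  by exists p.
case: (arg_maxnP (P := fun p => p \in N v) idx qv) => p pv pm /(_ p).
by rewrite pv /= => /negP[]; apply/forall_inP.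
Qed.

(** The route to [m] starts at some parent, so [m] is not later than the latest parent and
    [upreach_parent] applies. Hence the bags containing [m] are closed under parents up to the bag
    of [m]. *)
Lemma upreach_deepest v q m : q \in N v -> m \in upreach N k v -> m != v ->
  exists2 p, deepest_parent v = Some p & m \in upreach N k p.
Proof.
move=> /deepest_parentP[p pE [pv pm]] mv mneq; exists p => //.
apply: (upreach_parent eN pv mv).
move: mv; case: (k) => [|j]; first by rewrite inE (negPf mneq).
case/upreachSP=> [/eqP|[q' q'v mq']]; first by rewrite (negPf mneq).
exact: leq_trans (upreach_idx eN mq') (pm _ q'v).
Qed.

Lemma reach_graph_treewidth t :
  (forall v, #|N v| <= t) -> treewidth_le reach_graph ('C(k + t, t) - 1).
Proof.
move=> Nt.
(* The extra root [None] joins the vertices without parents into one tree. *)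
pose par (x : option V) := if x is Some v then deepest_parent v else None.
pose d (x : option V) := if x is Some v then (idx v).+1 else 0.
have pd x : x != None -> d (par x) < d x.
  case: x => //= v _; rewrite /deepest_parent; case: pickP => //= p /andP[pv _].
  by rewrite ltnS (elim_lt eN pv).
pose B (x : option V) : {set V} := if x is Some v then upreach N k v else set0.
exists (parent_graph pd), B; split; last first.
  move=> [v|] /=; last by rewrite cards0.
  by rewrite subn1 prednK ?bin_gt0 ?leq_addl // (card_upreach k v eN).
split; first exact: parent_graph_tree.
- by move=> v; exists (Some v); apply: upreach_self.
- move=> u v /andP[_ /orP[uv|vu]]; [exists (Some v)|exists (Some u)] => /=.
    by rewrite uv upreach_self.
  by rewrite vu upreach_self.
- move=> v; apply: (@parent_graph_connected_in _ _ _ _ pd _ (Some v)).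
  move=> [u|]; rewrite !inE //= => vu uv; split=> //.
  have vu' : v != u by apply: contraNneq uv => ->.
  have [q qu] : exists q, q \in N u.
    move: vu; case: (k) => [|j]; first by rewrite inE (negPf vu').
    case/upreachSP=> [/eqP|[q qu _]]; first by rewrite (negPf vu').
    by exists q.
  by have [p -> vp] := upreach_deepest qu vu vu'.
Qed.

End ReachGraph.

(** * Embedding the power *)

Lemma divn_close k i j : 0 < k -> i <= j + k -> j <= i + k ->
  [|| i %/ k == j %/ k, (i %/ k).+1 == j %/ k | (j %/ k).+1 == i %/ k].
Proof.
move=> k0 ij ji.
(* Adding [k] raises the quotient by exactly one, so monotonicity of division suffices. *)
have := leq_div2r k ij; have := leq_div2r k ji.
rewrite !divnDr ?dvdnn // divnn k0; lia.
Qed.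

Lemma strong_adjE (A B : sgraph) (p q : strong A B) :
  adj p q = [&& p != q, adj_or_eq p.1 q.1 & adj_or_eq p.2 q.2].
Proof.
case: p q => [a b] [c e]; rewrite /= /strong_adj /adj_or_eq xpair_eqE /=.
have [->|ac] := eqVneq a c; have [->|be] := eqVneq b e; rewrite ?adj_irrefl /= ?orbF //.
by rewrite andbF orbF andbT.
Qed.

Theorem theorem32 (t l D : nat) (G : sgraph) :
  0 < t -> 0 < l -> 0 < D ->
  maxdeg G = D ->
  (exists (H : sgraph) (n : nat),
      treewidth_le H t /\ subgraph G (strong (strong H (pathg n)) (complete l))) ->
  forall k : nat, 1 <= k ->
    exists (J : sgraph) (n : nat),
      treewidth_le J ('C(k + t, t) - 1) /\
      subgraph (power G k)
        (strong (strong J (pathg n)) (complete (2 * k * l * D ^ k * (k ^ 3 + 3 * k)))).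
Proof.
move=> t0 l0 D0 degG [H [n [/treewidth_elimination[idx [N [eN Nt HN]]] [f [finj fadj]]]]] k k0.
pose h v := (f v).1.1; pose row v := (f v).1.2; pose col v := (f v).2.
have fE u v : adj u v -> adj_or_eq (h u) (h v) /\ adj_or_eq (row u) (row v).
  move/fadj; rewrite strong_adjE => /and3P[_ /orP[/eqP e|e] _].
    by rewrite /h /row e !adj_or_eq_refl.
  by move: e; rewrite strong_adjE => /and3P[].
have hN u v : adj u v -> [\/ h u = h v, h u \in N (h v) | h v \in N (h u)].
  by move/fE => [/orP[/eqP|/HN[]] ? _]; [apply: Or31|apply: Or32|apply: Or33].
have rowE u v j : within j u v -> row u <= row v + j /\ row v <= row u + j.
  elim: j u => [|j IH] u; first by rewrite within0 => /eqP->; rewrite addn0.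
  case/withinSP=> w uw /IH; case/orP: uw => [/eqP->|/fE[_]]; first by lia.
  by case/orP=> [/eqP->|/orP[/eqP|/eqP]]; lia.
have aex v : exists z, within k v z /\ forall y, within k v y -> idx (h z) <= idx (h y).
  case: (arg_minnP (P := within k v) (idx \o h) (within_refl k v)) => z vz zm.
  by exists z.
have {aex}[z zP] := fin_all_exists aex.
pose a v : reach_graph N k := h (z v).
have az v : a v \in upreach N k (h v).
  have [/withinP[s [sz ps ls]] zm] := zP v; rewrite /a -ls -sz.
  apply: (upreach_walk eN hN ps) => x xs; rewrite ls; apply: zm.
  by rewrite -sz; apply: within_prefix xs.
have anear v w : within k v w -> idx (a v) <= idx (a w) -> a v \in upreach N k (a w).
  move=> /within_sym_imp/withinP[s [sz ps ls]] avw.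
  (* Both [a v] and [a w] lie above [h v]: the former within [k] steps, the latter within [k + k] by
     following the walk from [w] to [v]. Only the first count survives. *)
  apply: (upreach_between (i := k + k) (x := h v) eN) (az v) avw.
  rewrite -ls -{2}sz; apply: (upreach_walk_end eN hN ps) (az w) => x xs.
  by have [_] := zP w; apply; rewrite -sz; apply: within_prefix; rewrite // inE xs orbT.
have aE v w : within k v w -> adj_or_eq (a v) (a w).
  move=> vw; rewrite /adj_or_eq /= /reach_adj; have [//|_] := eqVneq (a v) (a w).
  case/orP: (leq_total (idx (a v)) (idx (a w))) => le.
    by rewrite (anear v w vw le).
  by rewrite (anear w v (within_sym_imp vw) le) orbT.
set M := 2 * _ * _ * _ * _.
have blk v : row v %/ k < n.+1 by apply: leq_ltn_trans (leq_div _ _) (ltn_ord _).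
pose b v : pathg n := Ordinal (blk v).
pose cls v := [set u | (a u == a v) && (b u == b v)].
have clsM v : #|cls v| <= M.
  have [q qE] : exists q, q = row v %/ k by exists (row v %/ k).
  (* These rows form block [q] with [k] more on each side, [3 * k] in all; adding [k] avoids
     truncated subtraction. Each [z u] with [u] in the fibre lies here. *)
  pose Z := [set y | [&& h y == a v, q * k <= row y + k & row y + k < q * k + 3 * k]].
  have Zcard : #|Z| <= 3 * k * l.
    pose g (y : G) := (inord (row y + k - q * k) : 'I_(3 * k).-1.+1, col y).
    have k3 : (3 * k).-1.+1 = 3 * k by rewrite prednK // muln_gt0.
    have -> : 3 * k * l = #|{: 'I_(3 * k).-1.+1 * complete l}|.
      by rewrite card_prod !card_ord k3.
    rewrite -(card_in_imset (f := g)) ?max_card // => y y'.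
    rewrite !inE => /and3P[/eqP hy y1 y2] /and3P[/eqP hy' y1' y2'] [/(congr1 val) /=].
    rewrite !inordK ?k3; [|lia|lia] => ry cy; apply: finj.
    have {}ry : row y = row y' by apply: val_inj => /=; lia.
    move: ry cy; rewrite -hy' in hy; move: hy; rewrite /h /row /col.
    by case: (f y) (f y') => [[? ?] ?] [[? ?] ?] /= -> -> ->.
  have sub : cls v \subset \bigcup_(y in Z) [set u | within k y u].
    apply/subsetP => u; rewrite inE => /andP[/eqP au /eqP/(congr1 val) /= bu].
    have [uz _] := zP u; apply/bigcupP; exists (z u); last by rewrite inE within_sym_imp.
    rewrite inE -au eqxx qE -bu /=; have [] := rowE _ _ _ uz.
    by have := divn_eq (row u) k; have := ltn_pmod (row u) k0; lia.
  apply: (leq_trans (subset_leq_card sub)).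
  apply: (leq_trans (leq_card_bigcup (m := k.+1 * D ^ k) _)).
    by move=> y _; rewrite -degG card_ball // degG.
  apply: (leq_trans (leq_mul Zcard (leqnn _))); rewrite /M.
  (* It remains to compare [3 * k.+1] with [2 * (k ^ 3 + 3 * k)], where [k] and [k ^ 3] are at least
     one. *)
  have -> : 3 * k * l * (k.+1 * D ^ k) = k * l * D ^ k * (3 * k.+1) by lia.
  have -> : 2 * k * l * D ^ k * (k ^ 3 + 3 * k) = k * l * D ^ k * (2 * (k ^ 3 + 3 * k)) by lia.
  by rewrite leq_mul2l; apply/orP; right; have := expn_gt0 k 3; lia.
have cls_self v : v \in cls v by rewrite inE !eqxx.
have idxM v : index v (enum (cls v)) < M.
  by apply: leq_trans (clsM v); rewrite cardE index_mem mem_enum.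
(* Numbering each fibre of [a] and [b] separates its vertices, which makes the combined map
   injective. *)
pose c v : complete M := Ordinal (idxM v).
exists (reach_graph N k), n; split; first exact: reach_graph_treewidth eN _ Nt.
exists (fun v => ((a v, b v), c v)).
have ginj : injective (fun v => ((a v, b v), c v)).
  move=> u v /= [auv buv cuv]; have buv' : b u = b v by apply: val_inj.
  have cE : cls u = cls v by rewrite /cls auv buv'.
  rewrite -(nth_index u (s := enum (cls u)) (x := u)) ?mem_enum //.
  by rewrite cuv cE nth_index // mem_enum.
split=> // u v /andP[uv wuv].
have uv' : ((a u, b u), c u) != ((a v, b v), c v) by rewrite (inj_eq ginj).
rewrite strong_adjE uv' /=; apply/andP; split; last first.
  by rewrite /adj_or_eq /= /complete_adj orbN.
rewrite {1}/adj_or_eq strong_adjE; case: eqP => //= _.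
rewrite aE //= /adj_or_eq /= /path_adj -val_eqE /=.
by have [? ?] := rowE _ _ _ wuv; apply: divn_close.
Qed.
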